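(* Let $\mathcal{M}=(Q,A,\tau)$ be a self-invertible Mealy automaton and let $u\in A^*$ be a nonempty word. Then the following statements are equivalent: (1) $|P_{\mathcal{M}}\cdot u^\omega|<\infty$; (2) $\left|[P_{\mathcal{M}}\cdot u^n]_{\stackrel{A}{\sim}}\right|$ is bounded independently of $n$; (3) $\left|[P_{\mathcal{M}}\cdot u^n]_{\stackrel{D}{\sim}}\right|$ is bounded independently of $n$; (4) $\left|\left[\bigcup_{n=0}^{\infty}P_{\mathcal{M}}\cdot u^n\right]_{\stackrel{A}{\sim}}\right|<\infty$; (5) $\left|\left[\bigcup_{n=0}^{\infty}P_{\mathcal{M}}\cdot u^n\right]_{\stackrel{D}{\sim}}\right|<\infty$; (6) $[u]_{\stackrel{A}{\sim}}$ has finite order in $D_{\mathcal{M}}$; (7) $[u]_{\stackrel{D}{\sim}}$ has finite order in $D'_{\mathcal{M}}$.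
   Context: A Mealy automaton is a tuple $\mathcal{M}=(Q,A,\tau)$ where $Q$ (states) and $A$ (alphabet) are finite sets and $\tau\colon Q\times A\to A\times Q$ is a map; write $\tau(q,a)=(q\cdot a,\,q@a)$. $Q^*$ and $A^*$ denote the free monoids (finite words, with empty word $\epsilon$). The operations extend uniquely to a left action $\cdot$ of $Q^*$ on the set $A^*$ and a right action $@$ of $A^*$ on the set $Q^*$ by: $s\cdot\epsilon=\epsilon$, $s@\epsilon=s$, $\epsilon\cdot u=u$, $\epsilon@u=\epsilon$, $s\cdot(uv)=(s\cdot u)\,((s@u)\cdot v)$, $s@(uv)=(s@u)@v$, $(st)\cdot u=s\cdot(t\cdot u)$, $(st)@u=(s@(t\cdot u))\,(t@u)$. The action $\cdot$ preserves lengths and is compatible with prefixes, hence extends to right-infinite words $A^\omega$; $u^\omega=uuu\cdots$. Congruences: on $Q^*$, $s\stackrel{Q}{\sim}t$ iff $s\cdot u=t\cdot u$ for all $u\in A^*$; on $A^*$, $u\stackrel{A}{\sim}v$ iff $s@u=s@v$ for all $s\in Q^*$; on $A^*$, $u\stackrel{D}{\sim}v$ iff $s@u\stackrel{Q}{\sim}s@v$ for all $s\in Q^*$. Put $P_{\mathcal{M}}=Q^*/{\stackrel{Q}{\sim}}$, $D_{\mathcal{M}}=A^*/{\stackrel{A}{\sim}}$, $D'_{\mathcal{M}}=A^*/{\stackrel{D}{\sim}}$. $P_{\mathcal{M}}$ acts on $A^*$ and $A^\omega$ through $\cdot$. For a set $X\subseteq A^*$, $[X]_{\sim}$ is the set of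 classes of elements of $X$. $\mathcal{M}$ is self-invertible if $P_{\mathcal{M}}$ is a group. An element has finite order if the subsemigroup it generates is finite. *)

(* Defs.v *)
From HB Require Import structures.
From mathcomp Require Import all_boot.
From mathcomp Require Import boolp classical_sets functions cardinality.

Set Implicit Arguments.
Unset Strict Implicit.
Unset Printing Implicit Defensive.

Local Open Scope classical_set_scope.
Local Open Scope quotient_scope.

Section QuotientOfFreeMonoid.
Variable T : choiceType.

Record congruence := Congruence {
  cong_rel :> seq T -> seq T -> Prop;
  cong_refl : forall x, cong_rel x x;
  cong_sym : forall x y, cong_rel x y -> cong_rel y x;
  cong_trans : forall x y z, cong_rel x y -> cong_rel y z -> cong_rel x z;
  cong_cat : forall x x' y y',
    cong_rel x x' -> cong_rel y y' -> cong_rel (x ++ y) (x' ++ y') }.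

Variable R : congruence.

Definition cong_bool : rel (seq T) := fun x y => `[< R x y >].

Lemma cong_bool_refl : reflexive cong_bool.
Proof. by move=> x; apply/asboolP; exact: cong_refl. Qed.

Lemma cong_bool_sym : symmetric cong_bool.
Proof. by move=> x y; apply/asboolP/asboolP; exact: cong_sym. Qed.

Lemma cong_bool_trans : transitive cong_bool.
Proof.
by move=> y x z /asboolP xy /asboolP yz; apply/asboolP; apply: cong_trans yz.
Qed.

Canonical cong_equiv := EquivRel cong_bool
  cong_bool_refl cong_bool_sym cong_bool_trans.

Definition quot := {eq_quot cong_equiv}.

HB.instance Definition _ := Choice.on quot.
HB.instance Definition _ : EqQuotient (seq T) cong_bool quot :=
  EqQuotient.on quot.

Lemma pi_eqP x y : (\pi_quot x = \pi_quot y) <-> R x y.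
Proof. by split=> [/eqmodP/asboolP|xy]; last by apply/eqmodP/asboolP. Qed.

Lemma repr_quot x : R (repr (\pi_quot x)) x.
Proof. by apply/pi_eqP; rewrite reprK. Qed.

Definition quot_mul (x y : quot) : quot := \pi_quot (repr x ++ repr y).
Definition quot_one : quot := \pi_quot [::].

Lemma pi_cat x y : \pi_quot (x ++ y) = quot_mul (\pi_quot x) (\pi_quot y).
Proof.
by apply/pi_eqP/cong_sym; apply: cong_cat; exact: repr_quot.
Qed.

Lemma quot_mulA : associative quot_mul.
Proof.
move=> x y z; rewrite -(reprK x) -(reprK y) -(reprK z).
rewrite -(pi_cat (repr y) (repr z)) -(pi_cat (repr x) (repr y)).
by rewrite -!pi_cat catA.
Qed.

Lemma quot_1mul : left_id quot_one quot_mul.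
Proof. by move=> x; rewrite -(reprK x) -(pi_cat [::]). Qed.

Lemma quot_mul1 : right_id quot_one quot_mul.
Proof. by move=> x; rewrite -(reprK x) -(pi_cat _ [::]) cats0. Qed.

HB.instance Definition _ := isMonoid.Build quot quot_mulA quot_1mul quot_mul1.

End QuotientOfFreeMonoid.

Definition is_group (G : monoidType) : Prop :=
  forall x : G, exists y : G, (y * x = 1 /\ x * y = 1)%g.

Definition generated_subsemigroup (G : monoidType) (x : G) : set G :=
  smallest (fun S : set G => forall y z, S y -> S z -> S (y * z)%g) [set x].

Definition finite_order (G : monoidType) (x : G) : Prop :=
  finite_set (generated_subsemigroup x).

Definition word_pow (T : Type) (u : seq T) (n : nat) : seq T :=
  flatten (nseq n u).

(* u^omega : its n-th letter is the letter of u at position n mod |u|. *)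
Definition omega_pow (T : Type) (u : seq T) (u_gt0 : (0 < size u)%N) :
    nat -> T :=
  fun n => tnth (in_tuple u) (Ordinal (ltn_pmod n u_gt0)).

Definition mealy (Q A : finType) := Q * A -> A * Q.

Section MealyActions.
Variables (Q A : finType) (M : mealy Q A).

Fixpoint state_act (q : Q) (u : seq A) : seq A :=
  if u is a :: u' then (M (q, a)).1 :: state_act (M (q, a)).2 u' else [::].

Fixpoint state_trans (q : Q) (u : seq A) : Q :=
  if u is a :: u' then state_trans (M (q, a)).2 u' else q.

(* s . u *)
Definition act (s : seq Q) (u : seq A) : seq A := foldr state_act u s.

(* s @ u *)
Fixpoint trans (s : seq Q) (u : seq A) : seq Q :=
  if s is q :: s' then state_trans q (act s' u) :: trans s' u else [::].

Lemma act_letter q a : act [:: q] [:: a] = [:: (M (q, a)).1].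
Proof. by []. Qed.

Lemma trans_letter q a : trans [:: q] [:: a] = [:: (M (q, a)).2].
Proof. by []. Qed.

Lemma act_nil s : act s [::] = [::].
Proof. by elim: s => //= q s ->. Qed.

Lemma trans_nil s : trans s [::] = s.
Proof. by elim: s => //= q s ->; rewrite act_nil. Qed.

Lemma nil_act u : act [::] u = u.
Proof. by []. Qed.

Lemma nil_trans u : trans [::] u = [::].
Proof. by []. Qed.

Lemma state_act_cat q u v :
  state_act q (u ++ v) = state_act q u ++ state_act (state_trans q u) v.
Proof. by elim: u q => //= a u IH q; rewrite IH. Qed.

Lemma state_trans_cat q u v :
  state_trans q (u ++ v) = state_trans (state_trans q u) v.
Proof. by elim: u q => //= a u IH q. Qed.

Lemma act_cat s u v : act s (u ++ v) = act s u ++ act (trans s u) v.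
Proof. by elim: s => //= q s ->; rewrite state_act_cat. Qed.

Lemma trans_cat s u v : trans s (u ++ v) = trans (trans s u) v.
Proof. by elim: s => //= q s ->; rewrite act_cat state_trans_cat. Qed.

Lemma cat_act s t u : act (s ++ t) u = act s (act t u).
Proof. by rewrite /act foldr_cat. Qed.

Lemma cat_trans s t u : trans (s ++ t) u = trans s (act t u) ++ trans t u.
Proof. by elim: s => //= q s ->; rewrite cat_act. Qed.

Lemma size_act s u : size (act s u) = size u.
Proof.
elim: s => //= q s <-; elim: (act s u) q => //= a v IH q.
by rewrite IH.
Qed.

(* Right-infinite words are functions nat -> A; the n-th letter of s . w is the
   last letter of the image of the prefix of w of length n + 1. *)
Definition act_omega (s : seq Q) (w : nat -> A) : nat -> A :=
  fun n => last (w n) (act s (mkseq w n.+1)).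

Lemma mkseq_act_omega s w n : mkseq (act_omega s w) n = act s (mkseq w n).
Proof.
elim: n => [|n IH]; first by rewrite act_nil.
rewrite mkseqS IH /act_omega mkseqS -!cats1 act_cat last_cat; congr (_ ++ _).
have: size (act (trans s (mkseq w n)) [:: w n]) = 1%N by rewrite size_act.
by case: (act _ [:: w n]) => [|a []].
Qed.

Definition simQ (s t : seq Q) : Prop := forall u : seq A, act s u = act t u.

Definition simA (u v : seq A) : Prop :=
  forall s : seq Q, trans s u = trans s v.

Definition simD (u v : seq A) : Prop :=
  forall s : seq Q, simQ (trans s u) (trans s v).

Lemma simQ_trans s t u : simQ s t -> simQ (trans s u) (trans t u).
Proof.
move=> st v; have := st (u ++ v); rewrite !act_cat st => /eqP.
by rewrite eqseq_cat // eqxx => /eqP.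
Qed.

Lemma simQ_cat s s' t t' : simQ s s' -> simQ t t' -> simQ (s ++ t) (s' ++ t').
Proof. by move=> ss' tt' u; rewrite !cat_act tt' ss'. Qed.

Lemma simA_cat u u' v v' : simA u u' -> simA v v' -> simA (u ++ v) (u' ++ v').
Proof. by move=> uu' vv' s; rewrite !trans_cat uu' vv'. Qed.

Lemma simD_cat u u' v v' : simD u u' -> simD v v' -> simD (u ++ v) (u' ++ v').
Proof.
move=> uu' vv' s w; rewrite !trans_cat (vv' (trans s u) w).
exact/simQ_trans/uu'.
Qed.

Definition congQ : congruence Q := @Congruence Q simQ
  (fun _ _ => erefl) (fun _ _ st u => esym (st u))
  (fun _ _ _ st tr u => etrans (st u) (tr u)) simQ_cat.

Definition congA : congruence A := @Congruence A simA
  (fun _ _ => erefl) (fun _ _ uv s => esym (uv s))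
  (fun _ _ _ uv vw s => etrans (uv s) (vw s)) simA_cat.

Definition congD : congruence A := @Congruence A simD
  (fun _ _ _ => erefl) (fun _ _ uv s x => esym (uv s x))
  (fun _ _ _ uv vw s x => etrans (uv s x) (vw s x)) simD_cat.

Definition PM : monoidType := quot congQ.
Definition DM : monoidType := quot congA.
Definition DM' : monoidType := quot congD.

Definition classQ (s : seq Q) : PM := \pi_(quot congQ) s.
Definition classA (u : seq A) : DM := \pi_(quot congA) u.
Definition classD (u : seq A) : DM' := \pi_(quot congD) u.

Definition PM_act (p : PM) (u : seq A) : seq A := act (repr (p : quot congQ)) u.

Definition PM_act_omega (p : PM) (w : nat -> A) : nat -> A :=
  act_omega (repr (p : quot congQ)) w.

Lemma PM_actE s u : PM_act (classQ s) u = act s u.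
Proof. exact: (repr_quot congQ). Qed.

Lemma PM_act_omegaE s w : PM_act_omega (classQ s) w = act_omega s w.
Proof.
by apply/funext => n; rewrite /PM_act_omega /act_omega (repr_quot congQ).
Qed.

Definition orbit_word (u : seq A) : set (seq A) :=
  [set PM_act p u | p in [set: PM]].

Definition orbit_omega (w : nat -> A) : set (nat -> A) :=
  [set PM_act_omega p w | p in [set: PM]].

Definition self_invertible : Prop := is_group PM.

End MealyActions.

(* Main.v *)
Require Import Defs.
From mathcomp Require Import all_boot.
From mathcomp Require Import boolp classical_sets functions cardinality.
Local Open Scope classical_set_scope.
Local Open Scope card_scope.

(** All seven conditions say that some two powers [u^i] and [u^j], [i < j], act
    in the same way on states.  This is to be understood up to [simA] or only up
    to [simD]; the orbit of [u^omega] is what leads from [simD] back to [simA].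

    Suppose [u^i] and [u^j] are equivalent, even only for [simD].  Then for every
    [s] the element [t := s @ u^i] satisfies [t @ u^(j-i) ~ t], so [t . u^omega]
    is periodic with period [t . u^(j-i)], and [s . u^omega] is determined by the
    finite word [s . u^j]: the orbit of [u^omega] is finite
    ([finite_order_orbit_omega]).

    Conversely, suppose that the orbit of [u^omega] has at most [N] points, or
    that for every [n] the orbit of the class of [u^n] does.  For each [n] the
    orbit is then a finite graph on at most [N] vertices in which [q : Q] sends
    the vertex of [s] to that of [q :: s]; label this edge by the letter
    [q @ (s . u^n)].  Reading [s] along its path from the base vertex spells
    [s @ u^n], so the labelled graph determines the action of [u^n] on states.
    There are finitely many such graphs, so two of them agree, and hence two
    powers of [u] are equivalent ([bounded_states_repeat]).  For infinite words
    the labels are well defined as letters, which yields the equivalence [simA];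
    for classes modulo [simD] they are well defined modulo [simQ], which yields
    [simD].

    For the edges to be well defined, [Q^*] must act on the classes modulo
    [simD]; it does when [P_M] is a group, because one can cancel in [P_M]
    ([simD_act]).

    Finally, [simA] is always preserved by the action ([simA_act]), so if [u^n]
    is [simA]-equivalent to one of finitely many powers, then the orbits of all
    [u^n] together meet finitely many classes ([finite_order_classA_orbits]). *)

(** * Pigeonhole principles *)

Lemma finite_pigeonhole {T : Type} {B : set T} (f : nat -> T) :
  finite_set B -> (forall n, B (f n)) -> exists i j, i < j /\ f i = f j.
Proof.
move=> finB Bf; apply: contrapT => no_rep; apply: infinite_nat.
have <- : f @^-1` B = [set: nat] by apply/seteqP; split=> n // _; exact: Bf.
apply: finite_preimage finB => i j _ _ fij.
by case: (ltngtP i j) => // ij; case: no_rep; [exists i, j | exists j, i].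
Qed.

Lemma finite_setT_finType (T : finType) : finite_set [set: T].
Proof.
have -> : [set: T] = [set` enum T].
  by apply/seteqP; split=> x //= _; rewrite mem_enum.
exact: finite_seq.
Qed.

(** Numbering the values of [f] by [N] codes turns later data about [f] into
    elements of a finite type, to which the pigeonhole principle applies. *)
Lemma card_le_code {X K : Type} {f : X -> K} {N : nat} :
  range f #<= `I_N -> exists e : X -> 'I_N, forall x y, e x = e y <-> f x = f y.
Proof.
move=> /pcard_leP[g].
have g_lt x : g (f x) < N by have /(_ (f x)) := @funS _ _ _ _ g; apply; exists x.
exists (fun x => Ordinal (g_lt x)) => x y; split=> [[]|eq_f].
  by apply: (inj (f := g)); rewrite inE; [exists x | exists y].
by apply: val_inj; rewrite /= eq_f.
Qed.

(** * Elements of finite order in a monoid *)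

Lemma expg_reduce {G : monoidType} {x : G} {i j : nat} (n : nat) :
  i < j -> (x ^+ i = x ^+ j)%g -> exists2 r, r < j & (x ^+ n = x ^+ r)%g.
Proof.
move=> lt_ij eq_x; elim: n => [|n [r lt_rj eq_n]].
  by exists 0; first exact: leq_ltn_trans lt_ij.
rewrite expgS eq_n -expgS.
have [lt_Srj|le_jSr] := ltnP r.+1 j; first by exists r.+1.
have -> : r.+1 = j by apply/eqP; rewrite eqn_leq lt_rj.
by exists i.
Qed.

Lemma generated_subsemigroupX {G : monoidType} (x : G) (n : nat) :
  generated_subsemigroup x (x ^+ n.+1)%g.
Proof.
elim: n => [|n IH]; first by rewrite expg1; exact: sub_gen_smallest.
rewrite expgS => S [S_mul Sx]; by apply: (S_mul); [exact: Sx | exact: (IH S)].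
Qed.

(** The generated subsemigroup consists of the positive powers only, but
    [i = 0] is harmless on the right: [1 = x^j] implies [x = x^(j+1)]. *)
Lemma finite_orderP {G : monoidType} (x : G) :
  finite_order x <-> exists i j, i < j /\ (x ^+ i = x ^+ j)%g.
Proof.
split=> [fin_x | [i [j [lt_ij eq_x]]]].
  have [i [j [lt_ij eq_x]]] :=
    finite_pigeonhole _ fin_x (generated_subsemigroupX x).
  by exists i.+1, j.+1.
apply: (sub_finite_set (B := (fun n => x ^+ n)%g @` `I_j)); last first.
  exact/finite_image/finite_II.
apply: smallest_sub => [y z [m _ <-] [n _ <-] | _ ->].
  have [r lt_rj eq_r] := expg_reduce (m + n) lt_ij eq_x.
  by exists r => //; rewrite -expgnDr.
have [r lt_rj eq_r] := expg_reduce 1 lt_ij eq_x.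
by exists r => //; rewrite -eq_r expg1.
Qed.

(** * Powers of a word *)

Lemma word_powS {T : Type} (u : seq T) (n : nat) :
  word_pow u n.+1 = u ++ word_pow u n.
Proof. by []. Qed.

Lemma word_powD {T : Type} (u : seq T) (m n : nat) :
  word_pow u (m + n) = word_pow u m ++ word_pow u n.
Proof. by rewrite /word_pow nseqD flatten_cat. Qed.

Lemma size_word_pow {T : Type} (u : seq T) (n : nat) :
  size (word_pow u n) = n * size u.
Proof. by elim: n => //= n IH; rewrite word_powS size_cat IH. Qed.

(** This is the bridge between [u^omega] and the powers of [u]: statements about
    the action on [u^omega] are read off on prefixes of length a multiple of
    [size u]. *)
Lemma mkseq_omega_pow {T : Type} (u : seq T) (u_gt0 : 0 < size u) (n : nat) :
  mkseq (omega_pow u_gt0) (n * size u) = word_pow u n.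
Proof.
elim: n => // n IH; rewrite word_powS -IH mulSn /mkseq iotaD map_cat add0n.
congr (_ ++ _).
  case: u u_gt0 {IH} => // a u u_gt0.
  apply: (@eq_from_nth _ a) => [|i]; rewrite size_map size_iota // => lt_iu.
  rewrite (nth_map 0) ?size_iota // nth_iota // add0n /omega_pow.
  by rewrite (tnth_nth a) /= modn_small.
rewrite -[X in iota X _]addn0 iotaDl -map_comp; apply: eq_map => i /=.
by rewrite /omega_pow; congr tnth; apply: val_inj; rewrite /= modnDl.
Qed.

Lemma omega_word_ext {T : Type} {w w' : nat -> T} :
  (forall n, exists2 p, n < p & mkseq w p = mkseq w' p) -> w = w'.
Proof.
move=> eq_ww'; apply/funext => n; have [p lt_np eq_p] := eq_ww' n.
by rewrite -(nth_mkseq (w n) w lt_np) eq_p nth_mkseq.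
Qed.

Lemma classA_pow {Q A : finType} (M : mealy Q A) (u : seq A) (n : nat) :
  classA M (word_pow u n) = (classA M u ^+ n)%g.
Proof. by elim: n => // n IH; rewrite word_powS expgS -IH; exact: pi_cat. Qed.

Lemma classD_pow {Q A : finType} (M : mealy Q A) (u : seq A) (n : nat) :
  classD M (word_pow u n) = (classD M u ^+ n)%g.
Proof. by elim: n => // n IH; rewrite word_powS expgS -IH; exact: pi_cat. Qed.

Lemma classA_eqP {Q A : finType} {M : mealy Q A} {v w : seq A} :
  classA M v = classA M w <-> simA M v w.
Proof. exact: (pi_eqP (congA M)). Qed.

Lemma classD_eqP {Q A : finType} {M : mealy Q A} {v w : seq A} :
  classD M v = classD M w <-> simD M v w.
Proof. exact: (pi_eqP (congD M)). Qed.

Lemma finite_order_simAP {Q A : finType} (M : mealy Q A) (u : seq A) :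
  finite_order (classA M u) <->
  exists i j, i < j /\ simA M (word_pow u i) (word_pow u j).
Proof.
rewrite finite_orderP; split=> -[i [j [lt_ij eq_u]]]; exists i, j; split=> //.
  by apply/classA_eqP; rewrite !classA_pow.
by rewrite -!classA_pow; apply/classA_eqP.
Qed.

Lemma finite_order_simDP {Q A : finType} (M : mealy Q A) (u : seq A) :
  finite_order (classD M u) <->
  exists i j, i < j /\ simD M (word_pow u i) (word_pow u j).
Proof.
rewrite finite_orderP; split=> -[i [j [lt_ij eq_u]]]; exists i, j; split=> //.
  by apply/classD_eqP; rewrite !classD_pow.
by rewrite -!classD_pow; apply/classD_eqP.
Qed.

Lemma simA_simD {Q A : finType} {M : mealy Q A} {v w : seq A} :
  simA M v w -> simD M v w.
Proof. by move=> vw s x; rewrite vw. Qed.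

(** * Orbits, and the action on congruence classes *)

Lemma orbit_wordE {Q A : finType} (M : mealy Q A) (u : seq A) :
  orbit_word M u = range (act M ^~ u).
Proof.
apply/seteqP; split=> _ [p _ <-]; first by exists (repr (p : quot (congQ M))).
by exists (classQ M p) => //; exact: PM_actE.
Qed.

Lemma orbit_omegaE {Q A : finType} (M : mealy Q A) (w : nat -> A) :
  orbit_omega M w = range (act_omega M ^~ w).
Proof.
apply/seteqP; split=> _ [p _ <-]; first by exists (repr (p : quot (congQ M))).
by exists (classQ M p) => //; exact: PM_act_omegaE.
Qed.

Lemma finite_words {A : finType} (n : nat) :
  finite_set [set v : seq A | size v = n].
Proof.
apply: (sub_finite_set (B := (@tval n A) @` [set: n.-tuple A])).
  by move=> v /= /eqP v_n; exists (Tuple v_n).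
exact/finite_image/finite_setT_finType.
Qed.

Lemma finite_orbit_word {Q A : finType} (M : mealy Q A) (u : seq A) :
  finite_set (orbit_word M u).
Proof.
apply: sub_finite_set (finite_words (size u)) => _ [p _ <-]; exact: size_act.
Qed.

Lemma act_omega_cons {Q A : finType} (M : mealy Q A) q s (w : nat -> A) :
  act_omega M (q :: s) w = act_omega M [:: q] (act_omega M s w).
Proof.
by apply: omega_word_ext => n; exists n.+1 => //; rewrite !mkseq_act_omega.
Qed.

(** [(t s) @ v] is the concatenation of [t @ (s . v)] and [s @ v], and the second
    factor has length [size s] whatever [v] is, so an equality of such
    concatenations is an equality of both factors. *)
Lemma simA_act {Q A : finType} {M : mealy Q A} {v w : seq A} (s : seq Q) :
  simA M v w -> simA M (act M s v) (act M s w).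
Proof.
move=> vw t; have := vw (t ++ s); rewrite !cat_trans vw => /eqP.
rewrite eqseq_cat ?eqxx ?andbT => [/eqP //|].
have size_trans r x : size (trans M r x) = size r by elim: r => //= ? ? ->.
by rewrite !size_trans.
Qed.

Lemma self_invertible_rinv {Q A : finType} {M : mealy Q A} (s : seq Q) :
  self_invertible M -> exists t, simQ M (s ++ t) [::].
Proof.
move=> /(_ (classQ M s))[y [_ sy]].
exists (repr (y : quot (congQ M))); apply/(pi_eqP (congQ M)).
by rewrite pi_cat reprK; exact: sy.
Qed.

(** As for [simA], but the concatenations are now only equal in [P_M]; the second
    factors are equal in [P_M] as well, and can be cancelled in a group. *)
Lemma simD_act {Q A : finType} {M : mealy Q A} {v w : seq A} (s : seq Q) :
  self_invertible M -> simD M v w -> simD M (act M s v) (act M s w).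
Proof.
move=> M_inv vw t x.
have [r r_inv] := self_invertible_rinv (trans M s v) M_inv.
have r_inv' : simQ M (trans M s w ++ r) [::].
  by move=> y; rewrite cat_act -vw -cat_act r_inv.
have := vw (t ++ s) (act M r x); rewrite !cat_trans !cat_act.
by rewrite -!(cat_act _ _ r) r_inv r_inv'.
Qed.

(** * Words with boundedly many states have two equivalent members *)

(** A labelled graph with vertices [C], as in the introduction, is encoded by
    [table]: the value at [(c, q)] is the end and the label of the edge [q] out
    of [c].  As in the action on words, the last letter of [s] is read first. *)
Fixpoint run {Q C : finType} (table : {ffun C * Q -> C * Q}) (c0 : C)
    (s : seq Q) : C * seq Q :=
  if s is q :: s' then
    let: (c, t) := run table c0 s' in
    let: (c', p) := table (c, q) in (c', p :: t)
  else (c0, [::]).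

(** The value [state n s] is meant to retain of [s] enough to know [q @ (s . v n)]
    up to [R] and the state of [q :: s], for every letter [q].  With [N]
    values per index [n], everything about the action of [v n] is encoded in a
    transition table over [N] codes, and there are finitely many tables. *)
Lemma bounded_states_repeat {Q A : finType} {M : mealy Q A} {K : Type}
    (R : congruence Q) (v : nat -> seq A) (N : nat) (state : nat -> seq Q -> K) :
  (forall n, range (state n) #<= `I_N) ->
  (forall n q s t, state n s = state n t ->
     state n (q :: s) = state n (q :: t) /\
     R (trans M [:: q] (act M s (v n))) (trans M [:: q] (act M t (v n)))) ->
  exists i j, i < j /\ forall s, R (trans M s (v i)) (trans M s (v j)).
Proof.
move=> bounded compat.
have /choice[code codeP] n := card_le_code (bounded n).
(* A code is sent where any word with that code goes; on codes that do not occur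
   the table is that of the empty word, and is never consulted. *)
pose witness n c : seq Q := xget [::] [set s | code n s = c].
pose table n : {ffun 'I_N * Q -> 'I_N * Q} := [ffun cq =>
  (code n (cq.2 :: witness n cq.1),
   state_trans M cq.2 (act M (witness n cq.1) (v n)))].
have tableP n s : let: (c, t) := run (table n) (code n [::]) s in
    c = code n s /\ R t (trans M s (v n)).
  elim: s => [|q s IH] /=; first by split=> //; exact: cong_refl.
  case: (run _ _ s) IH => _ t [-> IH]; rewrite ffunE /=.
  have wit_s : code n (witness n (code n s)) = code n s.
    by rewrite /witness; case: xgetP => [? -> //|/(_ s)]; case.
  move/codeP: wit_s => /(compat n q)[/codeP -> Rq]; split=> //.
  exact: cong_cat Rq IH.
have [i [j [lt_ij [eq_c eq_table]]]] := finite_pigeonhole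
  (fun n => (code n [::], table n)) (finite_setT_finType _) (fun=> I).
exists i, j; split=> // s.
have := tableP i s; rewrite eq_c eq_table; have := tableP j s.
case: run => c t [_ Rj] [_ Ri].
exact: cong_trans (cong_sym Ri) Rj.
Qed.

(** Equality of words is the instance of [R] that leads to [simA]. *)
Definition eq_cong (T : choiceType) : congruence T :=
  @Congruence T eq (@erefl _) (@esym _) (@etrans _)
    (fun _ _ _ _ xx' yy' => congr2 cat xx' yy').

(** * Finite order of the class of a word and finiteness of orbits *)

(** The state of [s] is [s . u^omega]; it has each [s . u^n] as a prefix, so that
    it determines the letter [q @ (s . u^n)] itself for every [n]. *)
Lemma finite_orbit_omega_order {Q A : finType} (M : mealy Q A) (u : seq A)
    (u_gt0 : 0 < size u) :
  finite_set (orbit_omega M (omega_pow u_gt0)) -> finite_order (classA M u).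
Proof.
set w := omega_pow u_gt0; rewrite orbit_omegaE => /finite_set_leP[N orbit_le].
apply/finite_order_simAP.
apply: (bounded_states_repeat (eq_cong Q) (word_pow u) N
  (fun=> act_omega M ^~ w)) => // n q s t eq_st; split.
  by rewrite act_omega_cons eq_st -act_omega_cons.
by rewrite -(mkseq_omega_pow u u_gt0) -!mkseq_act_omega eq_st.
Qed.

(** The state of [s] is the class of [s . u^n] modulo [simD]; it determines
    [q @ (s . u^n)] modulo [simQ], which is exactly what [simD] requires. *)
Lemma bounded_classD_order {Q A : finType} (M : mealy Q A) (u : seq A)
    (N : nat) :
  self_invertible M ->
  (forall n, [set classD M v | v in orbit_word M (word_pow u n)] #<= `I_N) ->
  finite_order (classD M u).
Proof.
move=> M_inv bounded; apply/finite_order_simDP.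
apply: (bounded_states_repeat (congQ M) (word_pow u) N
  (fun n s => classD M (act M s (word_pow u n)))) => [n|n q s t].
  by have := bounded n; rewrite orbit_wordE image_comp.
move=> /classD_eqP eq_st; split; last exact: eq_st.
by apply/classD_eqP; exact: (simD_act [:: q]).
Qed.

(** If [u^i] and [u^j] act alike on states up to [simQ], then [s . u^omega] is
    eventually periodic, with preperiod and period contained in [s . u^j]. *)
Lemma finite_order_orbit_omega {Q A : finType} (M : mealy Q A) (u : seq A)
    (u_gt0 : 0 < size u) :
  finite_order (classD M u) -> finite_set (orbit_omega M (omega_pow u_gt0)).
Proof.
set w := omega_pow u_gt0 => /finite_order_simDP[i [j [lt_ij sim_ij]]].
pose k := j - i.
have k_gt0 : 0 < k by rewrite subn_gt0.
have jE : j = i + k by rewrite subnKC // ltnW.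
have periodic s t n : act M s (word_pow u j) = act M t (word_pow u j) ->
    act M s (word_pow u (i + n * k)) = act M t (word_pow u (i + n * k)).
  rewrite jE !word_powD !act_cat => /eqP.
  rewrite eqseq_cat ?size_act // => /andP[/eqP -> /eqP eq_k]; congr (_ ++ _).
  (* [s @ u^i] is unchanged in [P_M] by [u^k], so reading more copies of [u^k]
     repeats the block that [u^k] itself produced. *)
  have stab r x : act M (trans M (trans M r (word_pow u i)) (word_pow u k)) x =
      act M (trans M r (word_pow u i)) x.
    by rewrite -trans_cat -word_powD -jE -sim_ij.
  elim: n => [|n IH]; first by rewrite !act_nil.
  by rewrite mulSn word_powD !act_cat eq_k !stab IH.
have omega_eq s t : act M s (word_pow u j) = act M t (word_pow u j) ->
    act_omega M s w = act_omega M t w.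
  move=> eq_st; apply: omega_word_ext => n.
  exists ((i + n.+1 * k) * size u); last first.
    by rewrite !mkseq_act_omega mkseq_omega_pow; apply: periodic.
  rewrite (@leq_trans (i + n.+1 * k)) ?leq_pmulr //.
  by rewrite (@leq_trans (n.+1 * k)) ?leq_pmulr ?leq_addl.
(* Choosing one [s] for each word [s . u^j] enumerates the whole orbit. *)
pose word v : seq Q := xget [::] [set s | act M s (word_pow u j) = v].
rewrite orbit_omegaE.
apply: (sub_finite_set
  (B := (fun v => act_omega M (word v) w) @` orbit_word M (word_pow u j))).
  move=> _ [s _ <-]; rewrite orbit_wordE.
  exists (act M s (word_pow u j)); first by exists s.
  by apply: omega_eq; rewrite /word; case: xgetP => [? -> //|/(_ s)]; case.
exact/finite_image/finite_orbit_word.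
Qed.

Lemma finite_order_classA_orbits {Q A : finType} (M : mealy Q A) (u : seq A) :
  finite_order (classA M u) ->
  finite_set [set classA M v | v in \bigcup_n orbit_word M (word_pow u n)].
Proof.
move=> /finite_orderP[i [j [lt_ij eq_ij]]].
apply: (sub_finite_set (B :=
  classA M @` \bigcup_(r in `I_j) orbit_word M (word_pow u r))); last first.
  apply/finite_image/bigcup_finite => [|r _]; first exact: finite_II.
  exact: finite_orbit_word.
move=> _ [v [n _ orbit_v] <-].
move: orbit_v; rewrite orbit_wordE => -[s _ <-].
have [r lt_rj eq_nr] := expg_reduce n lt_ij eq_ij.
exists (act M s (word_pow u r)); first by exists r; rewrite ?orbit_wordE.
by apply/classA_eqP/simA_act/classA_eqP; rewrite !classA_pow.
Qed.

Lemma bounded_of_finite_bigcup {T K : Type} (f : T -> K) (F : nat -> set T) :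
  finite_set (f @` \bigcup_n F n) -> exists N, forall n, f @` F n #<= `I_N.
Proof.
move=> /finite_set_leP[N le_N]; exists N => n; apply: card_le_trans le_N.
by apply: subset_card_le => _ [x Fx <-]; exists x => //; exists n.
Qed.

Lemma classD_of_classA {Q A : finType} (M : mealy Q A) (X : set (seq A)) :
  [set classD M v | v in X] #<= [set classA M v | v in X].
Proof.
have classDE v : classD M (repr (classA M v : quot (congA M))) = classD M v.
  by apply/classD_eqP/simA_simD; exact: (repr_quot (congA M)).
have -> : classD M @` X =
    (fun a : DM M => classD M (repr (a : quot (congA M)))) @` (classA M @` X).
  by rewrite image_comp; apply: eq_imagel => v _; rewrite /= classDE.
exact: card_image_le.
Qed.

Theorem lemma3p6 (Q A : finType) (M : mealy Q A) (u : seq A)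
    (M_inv : self_invertible M) (u_gt0 : (0 < size u)%N) :
  [<-> finite_set (orbit_omega M (omega_pow u_gt0));
       exists N : nat, forall n : nat,
         [set classA M v | v in orbit_word M (word_pow u n)] #<= `I_N;
       exists N : nat, forall n : nat,
         [set classD M v | v in orbit_word M (word_pow u n)] #<= `I_N;
       finite_set
         [set classA M v | v in \bigcup_n orbit_word M (word_pow u n)];
       finite_set
         [set classD M v | v in \bigcup_n orbit_word M (word_pow u n)];
       finite_order (classA M u);
       finite_order (classD M u)].
Proof.
have bounded_finite : (exists N : nat, forall n : nat,
    [set classD M v | v in orbit_word M (word_pow u n)] #<= `I_N) ->
    finite_set (orbit_omega M (omega_pow u_gt0)).
  move=> [N bounded]; apply: finite_order_orbit_omega.
  exact: bounded_classD_order M_inv bounded.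
tfae.
- move=> /finite_orbit_omega_order/finite_order_classA_orbits.
  exact: bounded_of_finite_bigcup.
- move=> [N bounded]; exists N => n.
  exact: card_le_trans (classD_of_classA M _) (bounded n).
- move=> /bounded_finite/finite_orbit_omega_order; exact: finite_order_classA_orbits.
- exact: card_le_finite (classD_of_classA M _).
- move=> /bounded_of_finite_bigcup/bounded_finite; exact: finite_orbit_omega_order.
- move=> /finite_order_simAP[i [j [lt_ij sim_ij]]].
  by apply/finite_order_simDP; exists i, j; split=> //; exact: simA_simD.
- exact: finite_order_orbit_omega.
Qed.
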